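(* Let $P$ be a finite, bounded poset with an EL-labeling $\lambda$. Then $\lambda$ fails to be polygon complete if and only if $P$ has some maximal chain of length at least three and there are elements $y,x_1,x_2,\dots,x_n,z_1,z_2,\dots,z_n\in P$, for some $n\ge 2$, which, under the convention $x_{n+1}=x_1$, satisfy: (i) For $1\le i\le n$, $z_i\lessdot x_{i+1}\lessdot y$ is a descent in $[z_i,y]$, and $x_i\lessdot y$ is contained in the unique ascending saturated chain $c_i$ of $[z_i,y]$ with respect to $\lambda$. (ii) There are saturated chains of length at least one, $m$ and $m'$ from $\hat 0$ to $x_1$ with $m\to m'$, and $m_i$ from $\hat 0$ to $z_i$ for $1\le i\le n$, which satisfy: $m\preceq_\lambda m_1*c_1^{x_1}$ in $[\hat 0,x_1]_\lambda(2)$; $m_i*z_i*x_{i+1}\prec_\lambda m_{i+1}*c_{i+1}^{x_{i+1}}$ in $[\hat 0,x_{i+1}]_\lambda(2)$ for each $1\le i\le n-1$; and $m_n*x_1\preceq_\lambda m'$ in $[\hat 0,x_1]_\lambda(2)$. (It is possible that $m$ contains $m_1$ and $c_1^{x_1}$.)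
   Context: A finite poset $P$ is bounded if it has a least element $\hat 0$ and a greatest element $\hat 1$; $x\lessdot y$ denotes a cover relation; $\mathcal M(P)$ is the set of maximal chains of $P$ (not all need have the same length). The length of a chain is its number of elements minus one. For a chain $c$ and $x\in c$ write $c^x=\{w\in c: w\le x\}$ and $c_x=\{w\in c: w\ge x\}$. If the largest element of $c_1$ is $\le$ the smallest element of $c_2$, then $c_1*c_2=c_1\cup c_2$; a single element is regarded as a one-element chain in this notation. An edge labeling $\lambda$ assigns to each cover relation $x\lessdot y$ a label $\lambda(x,y)$ in a poset $\Lambda$; a saturated chain gets the sequence of labels of its edges from bottom to top. A sequence is ascending if it is weakly increasing in $\Lambda$. One sequence lexicographically precedes another if at the first index where they differ the entry of the first is $<$ the entry of the second. $\lambda$ is an EL-labeling if for every $x<y$ the interval $[x,y]$ has a unique ascending maximal chain and this chain lexicographically precedes all other maximal chains of $[x,y]$. The restriction of an EL-labeling to a closed interval is an EL-labeling. A saturated chain $u\lessdot v\lessdot w$ is a descent if $\lambda(u,v)\not\le\lambda(v,w)$. Polygon move: for $m,m'\in\mathcal M(P)$ write $m\to m'$ if there are $x<z$ in $m\cap m'$ with $m^x=m'^x$, $m_z=m'_z$, such that $m'\cap[x,z]$ is a descent $x\lessdot y\lessdot z$ with $y\notin m$, while $m\cap[x,z]$ is the unique ascending maximal chain of $[x,z]$. The maximal chain descent order $P_\lambda(2)$ is the set $\mathcal M(P)$ partially ordered by the reflexive and transitive closure $\preceq_\lambda$ of $\to$; $\prec_\lambda$ is the strict order. For $x\in P$, $[\hat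 0,x]_\lambda(2)$ is the maximal chain descent order on the maximal chains of $[\hat 0,x]$ induced by the restriction of $\lambda$, and $\to$ between maximal chains of $[\hat 0,x]$ is the polygon move for that restriction. The labeling $\lambda$ is polygon complete if $m\to m'$ always implies that $m'$ covers $m$ in $P_\lambda(2)$. *)

(* Defs.v *)
From HB Require Import structures.
From mathcomp Require Import all_boot all_order.

Set Implicit Arguments.
Unset Strict Implicit.
Unset Printing Implicit Defensive.

Import Order.Theory.
Local Open Scope order_scope.

Section Chains.
Context {d : Order.disp_t} {P : finTBPOrderType d}.
Implicit Types (x y z w : P) (c : {set P}).

Definition covby x y : bool := (x < y) && [forall w, ~~ (x < w < y)].

Definition interval x y : {set P} := [set w | x <= w <= y].

Definition is_chain c : bool := [forall u in c, forall v in c, u >=< v].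

(* A saturated chain from x to y is the same thing as a maximal chain of
   [x, y]; the maximal chains of P are those of [\bot, \top]. *)
Definition maximal_chain x y c : bool :=
  maxset (fun b : {set P} => is_chain b && (b \subset interval x y)) c.

Definition chain_length c : nat := #|c|.-1.

Definition chain_below c x : {set P} := [set w in c | w <= x].
Definition chain_above c x : {set P} := [set w in c | x <= w].

Definition chain_seq c : seq P := sort <=%O (enum c).

End Chains.

Definition lex_precedes {d : Order.disp_t} {L : porderType d} (s t : seq L) : Prop :=
  exists (p : seq L) (a b : L) (s' t' : seq L),
    [/\ s = p ++ a :: s', t = p ++ b :: t' & a < b].

(* An edge labeling is a function on all pairs of elements, but only its values
   on cover relations are ever used. *)
Section Labeling.
Context {d : Order.disp_t} {P : finTBPOrderType d}.
Context {d' : Order.disp_t} {L : porderType d'}.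
Variable lam : P -> P -> L.
Implicit Types (x y z t : P) (c m : {set P}).

Definition labels c : seq L :=
  if chain_seq c is x :: s then pairmap lam x s else [::].

Definition ascending c : bool := sorted <=%O (labels c).

Definition unique_ascending x y c : bool :=
  [&& maximal_chain x y c, ascending c &
    [forall c' : {set P}, maximal_chain x y c' && ascending c' ==> (c' == c)]].

Definition EL_labeling : Prop :=
  forall x y, x < y ->
    exists c, unique_ascending x y c /\
      forall c', maximal_chain x y c' -> c' != c ->
        lex_precedes (labels c) (labels c').

Definition descent x y z : bool :=
  [&& covby x y, covby y z & ~~ (lam x y <= lam y z)].

(* The moves and the order below live on the maximal chains of [\bot, t], with
   the restricted labeling; t = \top gives the maximal chains of P. *)
Definition polygon_move t : rel {set P} := fun m m' =>
  [&& maximal_chain \bot t m, maximal_chain \bot t m' &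
    [exists x, exists z, exists y,
      [&& x < z, x \in m :&: m', z \in m :&: m',
          chain_below m x == chain_below m' x,
          chain_above m z == chain_above m' z,
          descent x y z, m' :&: interval x z == [set x; y; z], y \notin m &
          unique_ascending x z (m :&: interval x z)]]].

Definition mcd_le t : rel {set P} := fun m m' =>
  [&& maximal_chain \bot t m, maximal_chain \bot t m' &
      connect (polygon_move t) m m'].

Definition mcd_lt t : rel {set P} := fun m m' => mcd_le t m m' && (m != m').

Definition mcd_cover t : rel {set P} := fun m m' =>
  mcd_lt t m m' && [forall m'', ~~ (mcd_lt t m m'' && mcd_lt t m'' m')].

Definition polygon_complete : Prop :=
  forall m m', polygon_move \top m m' -> mcd_cover \top m m'.

End Labeling.

(* Main.v *)
Require Import Defs.
From HB Require Import structures.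
From mathcomp Require Import all_boot all_order.

Set Implicit Arguments.
Unset Strict Implicit.
Unset Printing Implicit Defensive.

Import Order.Theory.
Local Open Scope order_scope.

(** Every move strictly increases the label sequence lexicographically, because
    an ascending chain starts with a strictly smaller label than any descent with
    the same ends ([ascending_precedes_descent]); so chains of moves never return
    to their start.

    From the crossing data to incompleteness.  Append [y] and a fixed maximal
    chain above [y] to every chain in sight.  Moves below a coatom [x_i] of
    [[0, y]] stay moves, and the chains [m_i * c_i] and [m_i * z_i * x_(i+1) * y]
    become joined by a move with polygon [[z_i, y]].  Together they lead from the
    extension of [m] to that of [m'] in at least [n >= 2] moves, while these two
    extensions are themselves joined by a single move
    ([crossing_path_refines]).

    From incompleteness to the crossing data.  If some move is refined by a path
    of at least two moves, take such a refined move [m -> m'] in an interval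
    [[0, t]] as small as possible.
    - The polygon of [m -> m'] does not reach [t].  Otherwise let [n -> m'] be the
      last step of the refining path.  If its polygon began below the bottom [x]
      of that of [m -> m'], then [n] would precede [m] lexicographically, as [m]
      and [m'] agree up to [x]; so the last step uses a descent of [m'] above [x],
      where there is only one, and [n = m] ([move_at_top_last]).
    - So [m] and [m'] share their coatom [x_1], and dropping [t] leaves a move in
      [[0, x_1]].  By minimality the path cannot stay among the chains through
      [x_1].
    - Each step which changes the coatom has a polygon with top [t]: it leaves
      [m_i * c_i], whose coatom is [x_i], for [m_i * z_i * x_(i+1) * t].  All
      other steps happen below the current coatom.  Cutting the path at the
      coatom changes gives the data, with [y = t] ([path_crossings]).
    The comparisons in between are strict because the chain left behind by a
    crossing ends in a descent, while the chain entering the next one ends in an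
    ascending chain ([crossing_crossing_neq]).  No [z_i] is the bottom element, as
    [[0, x_(i+1)]] has at least two maximal chains. *)

(** * Maximal chains *)

Section MaximalChains.
Context {d : Order.disp_t} {P : finTBPOrderType d}.
Implicit Types (x y z w u v : P) (c m : {set P}).

Lemma covby_lt x y : covby x y -> x < y.
Proof. by case/andP. Qed.

Lemma covby_cases u v w :
  covby u v -> w >=< u -> w >=< v -> (w <= u) || (v <= w).
Proof.
case/andP=> _ /forallP/(_ w) nuwv /orP[-> //|uw] /orP[wv|->]; last exact: orbT.
move: nuwv; rewrite !lt_neqAle uw wv !andbT negb_and !negbK.
by case/orP=> /eqP->; rewrite lexx ?orbT.
Qed.

Lemma is_chainP c : reflect {in c &, forall u v, u >=< v} (is_chain c).
Proof.
apply: (iffP forall_inP) => [h u v uc vc|h u uc].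
  by have /forall_inP := h u uc; apply.
by apply/forall_inP => v vc; apply: h.
Qed.

(** Maximality as a closure property: an element of the interval comparable to
    the whole chain already lies on it.  This form restricts and glues. *)
Lemma maximal_chainP x y c :
  reflect [/\ is_chain c, {in c, forall w, x <= w <= y} &
              forall w, x <= w <= y -> {in c, forall v, w >=< v} -> w \in c]
          (maximal_chain x y c).
Proof.
apply: (iffP maxsetP) => [[/andP[cc /subsetP cI] cmax]|[cc cI cmax]].
  split=> // [w /cI|w xwy wc]; first by rewrite inE.
  suff <-: w |: c = c by rewrite setU11.
  apply: cmax; last exact: subsetUr.
  apply/andP; split; last first.
    by apply/subsetP=> v /setU1P[->|/cI //]; rewrite inE.
  apply/is_chainP=> u v /setU1P[->|uc] /setU1P[->|vc].
  - exact: comparablexx.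
  - exact: wc.
  - by rewrite comparable_sym wc.
  - exact: (is_chainP _ cc).
split.
  by rewrite cc; apply/subsetP=> w /cI; rewrite inE.
move=> b /andP[/is_chainP bc /subsetP bI] cb; apply/eqP.
rewrite eqEsubset cb andbT; apply/subsetP=> w wb; apply: cmax.
  by have := bI w wb; rewrite inE.
by move=> v vc; apply: bc => //; apply: (subsetP cb).
Qed.

Section OneChain.
Variables (x y : P) (c : {set P}).
Hypotheses (cmax : maximal_chain x y c).

Lemma maximal_chain_chain : is_chain c.
Proof. by case/maximal_chainP: cmax. Qed.

Lemma maximal_chain_comparable : {in c &, forall u v, u >=< v}.
Proof. exact/is_chainP/maximal_chain_chain. Qed.

Lemma maximal_chain_ge w : w \in c -> x <= w.
Proof. by case/maximal_chainP: cmax => _ cI _ /cI/andP[]. Qed.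

Lemma maximal_chain_le w : w \in c -> w <= y.
Proof. by case/maximal_chainP: cmax => _ cI _ /cI/andP[]. Qed.

Lemma maximal_chain_min : x <= y -> x \in c.
Proof.
case/maximal_chainP: cmax => _ cI h xy; apply: h; first by rewrite lexx.
by move=> v /cI/andP[xv _]; apply: le_comparable.
Qed.

Lemma maximal_chain_max : x <= y -> y \in c.
Proof.
case/maximal_chainP: cmax => _ cI h xy; apply: h; first by rewrite lexx andbT.
by move=> v /cI/andP[_ vy]; apply: ge_comparable.
Qed.

Lemma maximal_chain_covby_cases u v w :
  u \in c -> v \in c -> w \in c -> covby u v -> (w <= u) || (v <= w).
Proof.
by move=> uc vc wc uv; apply: covby_cases => //; apply: maximal_chain_comparable.
Qed.

Lemma maximal_chain_below u : u \in c -> maximal_chain x u (chain_below c u).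
Proof.
case/maximal_chainP: cmax => /is_chainP cc cI h uc; apply/maximal_chainP; split.
- by apply/is_chainP=> v w; rewrite !inE => /andP[vc _] /andP[wc _]; apply: cc.
- by move=> w; rewrite inE => /andP[/cI/andP[-> _] ->].
move=> w /andP[xw wu] wc; rewrite inE wu andbT; apply: h.
  by rewrite xw (le_trans wu) // maximal_chain_le.
move=> v vc; have /orP[vu|uv] := cc v u vc uc.
  by apply: wc; rewrite inE vc.
by apply: le_comparable; apply: le_trans uv.
Qed.

Lemma maximal_chain_above u : u \in c -> maximal_chain u y (chain_above c u).
Proof.
case/maximal_chainP: cmax => /is_chainP cc cI h uc; apply/maximal_chainP; split.
- by apply/is_chainP=> v w; rewrite !inE => /andP[vc _] /andP[wc _]; apply: cc.
- by move=> w; rewrite inE => /andP[/cI/andP[_ ->] ->].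
move=> w /andP[uw wy] wc; rewrite inE uw andbT; apply: h.
  by rewrite wy (le_trans _ uw) // maximal_chain_ge.
move=> v vc; have /orP[vu|uv] := cc v u vc uc.
  by apply: ge_comparable; apply: le_trans uw.
by apply: wc; rewrite inE vc.
Qed.

End OneChain.

Lemma maximal_chain_eq x y u c1 c2 :
  maximal_chain x y c1 -> maximal_chain x y c2 -> u \in c1 -> u \in c2 ->
  chain_below c1 u = chain_below c2 u ->
  c1 :&: interval u y = c2 :&: interval u y -> c1 = c2.
Proof.
move=> m1 m2 u1 u2 /setP eb /setP ei; apply/setP=> w.
have [wu|nwu] := boolP (w <= u); first by have := eb w; rewrite !inE wu !andbT.
have above c : maximal_chain x y c -> u \in c ->
    (w \in c) = (w \in c :&: interval u y).
  move=> mc uc; rewrite !inE; apply/esym/andb_idr => wc.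
  rewrite (maximal_chain_le mc wc) andbT.
  by have := maximal_chain_comparable mc wc uc; rewrite /(_ >=< _) (negPf nwu).
by rewrite (above _ m1 u1) (above _ m2 u2) ei.
Qed.

Lemma maximal_chain_glue x y z c1 c2 : x <= y -> y <= z ->
  maximal_chain x y c1 -> maximal_chain y z c2 ->
  maximal_chain x z (c1 :|: c2).
Proof.
move=> xy yz m1 m2.
have y1 := maximal_chain_max m1 xy.
case/maximal_chainP: (m1) => /is_chainP c1c c1I h1.
case/maximal_chainP: (m2) => /is_chainP c2c c2I h2.
have le12 u v : u \in c1 -> v \in c2 -> u <= v.
  by move=> /c1I/andP[_ uy] /c2I/andP[yv _]; apply: le_trans yv.
apply/maximal_chainP; split.
- apply/is_chainP=> u v; rewrite !inE => /orP[uc|uc] /orP[vc|vc].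
  + exact: c1c.
  + by apply: le_comparable; apply: le12.
  + by apply: ge_comparable; apply: le12.
  + exact: c2c.
- move=> w; rewrite inE => /orP[/c1I|/c2I] /andP[].
    by move=> -> wy; apply: le_trans yz.
  by move=> yw ->; rewrite (le_trans xy).
move=> w /andP[xw wz] wc; rewrite inE.
have /orP[wy|yw] : w >=< y by apply: wc; rewrite inE y1.
  rewrite h1 ?xw // => v vc.
  by apply: wc; rewrite inE vc.
rewrite h2 ?orbT ?yw // => v vc.
by apply: wc; rewrite inE vc orbT.
Qed.

Lemma maximal_chain_covby x y : covby x y -> maximal_chain x y [set x; y].
Proof.
move=> xy; have /ltW lexy := covby_lt xy; apply/maximal_chainP; split.
- apply/is_chainP=> u v /set2P[]-> /set2P[]->; rewrite ?comparablexx //.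
    exact: le_comparable.
  exact: ge_comparable.
- by move=> w /set2P[]->; rewrite lexx lexy.
move=> w /andP[xw wy] wc; rewrite !inE [w == x]eq_le [w == y]eq_le xw wy andbT /=.
by apply: covby_cases => //; apply: wc; rewrite !inE eqxx ?orbT.
Qed.

Lemma maximal_chain_covby_eq x y c :
  covby x y -> maximal_chain x y c -> c = [set x; y].
Proof.
move=> xy mc; have /ltW lexy := covby_lt xy.
have xc := maximal_chain_min mc lexy; have yc := maximal_chain_max mc lexy.
apply/setP=> w; rewrite !inE; apply/idP/orP => [wc|[]/eqP-> //].
have /orP[wx|yw] := maximal_chain_covby_cases mc xc yc wc xy.
  by left; rewrite eq_le wx (maximal_chain_ge mc).
by right; rewrite eq_le yw (maximal_chain_le mc).
Qed.

Lemma maximal_chain_extend x y c : is_chain c ->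
  {in c, forall w, x <= w <= y} -> exists2 c', maximal_chain x y c' & c \subset c'.
Proof.
move=> cc cI.
have [|c' ? ?] := @maxset_exists _ (fun b => is_chain b && (b \subset interval x y)) c.
  by rewrite cc; apply/subsetP=> w /cI; rewrite inE.
by exists c'.
Qed.

Lemma maximal_chain_coatom x y c : maximal_chain x y c -> x < y ->
  exists2 u, u \in c & covby u y.
Proof.
move=> mc xy; have lexy := ltW xy.
have xc := maximal_chain_min mc lexy; have yc := maximal_chain_max mc lexy.
have x_ok : (x \in c) && (x < y) by rewrite xc.
pose size_below u := #|chain_below c u|.
case: (@arg_maxnP _ x [pred u | (u \in c) && (u < y)] size_below x_ok).
move=> u /andP[uc uy] umax; exists u => //.
(* [u] has the most chain elements below it among those other than [y]. *)
have le_u v : v \in c -> v < y -> v <= u.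
  move=> vc vy; have /orP[//|uv] := maximal_chain_comparable mc vc uc.
  have v_ok : (v \in c) && (v < y) by rewrite vc.
  have sub : chain_below c u \subset chain_below c v.
    apply/subsetP=> w; rewrite !inE => /andP[-> wu]; exact: le_trans uv.
  have le_card : (#|chain_below c v| <= #|chain_below c u|)%N := umax v v_ok.
  have : v \in chain_below c v by rewrite inE vc lexx.
  have /eqP <- : chain_below c u == chain_below c v by rewrite eqEcard sub.
  by rewrite inE => /andP[].
rewrite /covby uy; apply/forallP=> w; apply/negP=> /andP[uw wy].
case/maximal_chainP: (mc) => _ cI h.
have wc : w \in c.
  apply: h.
    by rewrite (ltW wy) (le_trans _ (ltW uw)) // (maximal_chain_ge mc).
  move=> v vc; have := maximal_chain_le mc vc; rewrite le_eqVlt.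
  case/predU1P=> [->|vy]; first exact/le_comparable/ltW.
  by apply/ge_comparable/(le_trans (le_u v vc vy))/ltW.
by have := le_u w wc wy; rewrite lt_geF.
Qed.


End MaximalChains.

(** * Label sequences *)

Section Lexicographic.
Context {d : Order.disp_t} {L : porderType d}.
Implicit Types s t u : seq L.

Lemma lex_precedes_irr s : ~ lex_precedes s s.
Proof.
case=> p [a [b [s' [t' [-> /eqP]]]]].
by rewrite eqseq_cat // eqseq_cons => /and3P[_ /eqP-> _]; rewrite ltxx.
Qed.

Lemma lex_precedes_trans s t u :
  lex_precedes s t -> lex_precedes t u -> lex_precedes s u.
Proof.
case=> p [a [b [s' [t' [-> -> ltab]]]]] [q [b' [e [t'' [u' [tE -> ltbe]]]]]].
elim: p q tE => [|p0 p IHp] [|q0 q] /= [].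
- by move=> bE _; exists [::], a, e, s', u'; split=> //; rewrite (lt_trans ltab) ?bE.
- by move=> <- _; exists [::], a, b, s', (q ++ e :: u').
- by move=> -> _; exists [::], b', e, (p ++ a :: s'), u'.
move=> -> /IHp[p' [a1 [b1 [s1 [t1 [-> -> lt1]]]]]].
by exists (q0 :: p'), a1, b1, s1, t1.
Qed.

End Lexicographic.

Section Labels.
Context {d : Order.disp_t} {P : finTBPOrderType d}.
Context {d' : Order.disp_t} {L : porderType d'}.
Variable lam : P -> P -> L.
Implicit Types (x y z u v w t : P) (c m : {set P}).

Lemma chain_seq_sorted c : is_chain c -> sorted <%O (chain_seq c).
Proof.
move=> /is_chainP cc; rewrite lt_sorted_uniq_le sort_uniq enum_uniq /=.
apply: (sort_sorted_in (P := mem c)); last by apply/allP=> u; rewrite mem_enum.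
by move=> u v uc vc; apply: cc.
Qed.

Lemma mem_chain_seq c : chain_seq c =i c.
Proof. by move=> u; rewrite mem_sort mem_enum. Qed.

Lemma chain_seq_eq c s : is_chain c -> sorted <%O s -> s =i c -> chain_seq c = s.
Proof.
move=> cc ss sE; apply: lt_sorted_eq => //; first exact: chain_seq_sorted.
by move=> u; rewrite mem_chain_seq sE.
Qed.

Lemma is_chain_sub c c' : c' \subset c -> is_chain c -> is_chain c'.
Proof.
move=> /subsetP sub /is_chainP cc; apply/is_chainP=> u v /sub uc /sub vc.
exact: cc.
Qed.

Lemma chain_below_sub c u : chain_below c u \subset c.
Proof. by apply/subsetP=> w; rewrite inE => /andP[]. Qed.

Lemma chain_above_sub c u : chain_above c u \subset c.
Proof. by apply/subsetP=> w; rewrite inE => /andP[]. Qed.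

Lemma labels_split c u : is_chain c -> u \in c ->
  labels lam c = labels lam (chain_below c u) ++ labels lam (chain_above c u).
Proof.
move=> cc uc; have := chain_seq_sorted cc; have := mem_chain_seq c.
have : u \in chain_seq c by rewrite mem_chain_seq.
rewrite {1}/labels; case/path.splitPr => s1 s2 cE csort.
have lt1 : {in s1, forall v, v < u}.
  move=> v vs1; move: csort; rewrite sorted_pairwise; last exact: lt_trans.
  by rewrite pairwise_cat => /and3P[/allrelP h _ _]; apply: h; rewrite ?mem_head.
have lt2 : {in s2, forall v, u < v}.
  move=> v vs2; have := cat_sorted2 csort => -[_].
  by rewrite /= lt_path_sortedE => /andP[/allP/(_ v vs2)].
have bE : chain_seq (chain_below c u) = rcons s1 u.
  apply: chain_seq_eq; first exact: is_chain_sub (chain_below_sub c u) cc.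
    by move: csort; rewrite -[s1 ++ _]cat_rcons => /cat_sorted2[].
  move=> v; rewrite mem_rcons !inE -cE mem_cat inE.
  case: eqVneq => [->|_] /=; first by rewrite lexx orbT.
  have [/lt1/ltW-> //|_] /= := boolP (v \in s1).
  by have [/lt2/lt_geF->|] /= := boolP (v \in s2).
have aE : chain_seq (chain_above c u) = u :: s2.
  apply: chain_seq_eq; first exact: is_chain_sub (chain_above_sub c u) cc.
    by case: (cat_sorted2 csort).
  move=> v; rewrite !inE -cE mem_cat inE.
  case: eqVneq => [->|_] /=; first by rewrite lexx orbT.
  have [/lt2/ltW-> |_] /= := boolP (v \in s2); first by rewrite orbT.
  by have [/lt1/lt_geF->|] /= := boolP (v \in s1).
rewrite /labels bE aE; case: s1 {lt1 cE csort bE} => [//|v s1] /=.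
by rewrite -cat_rcons pairmap_cat last_rcons.
Qed.

Lemma labels_covby x y : covby x y -> labels lam [set x; y] = [:: lam x y].
Proof.
move=> xy; rewrite /labels (@chain_seq_eq _ [:: x; y]) //.
- exact: maximal_chain_chain (maximal_chain_covby xy).
- by rewrite /= covby_lt.
- by move=> w; rewrite !inE.
Qed.

Lemma labels_head x y u c : maximal_chain x y c -> x <= y -> u \in c ->
  covby x u -> labels lam c = lam x u :: labels lam (chain_above c u).
Proof.
move=> mc xy uc xu; rewrite (labels_split (maximal_chain_chain mc) uc).
by rewrite (maximal_chain_covby_eq xu (maximal_chain_below mc uc)) labels_covby.
Qed.

Lemma labels_last x y u c : maximal_chain x y c -> x <= y -> u \in c ->
  covby u y -> labels lam c = rcons (labels lam (chain_below c u)) (lam u y).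
Proof.
move=> mc xy uc uy; rewrite (labels_split (maximal_chain_chain mc) uc).
by rewrite (maximal_chain_covby_eq uy (maximal_chain_above mc uc)) labels_covby
           // cats1.
Qed.

Lemma ascending_covby x y c u v w : maximal_chain x y c -> x <= y ->
  ascending lam c -> u \in c -> v \in c -> w \in c -> covby u v -> covby v w ->
  lam u v <= lam v w.
Proof.
move=> mc xy; rewrite /ascending => asc uc vc wc uv vw.
have mb := maximal_chain_below mc vc; have ma := maximal_chain_above mc vc.
move: asc; rewrite (labels_split (maximal_chain_chain mc) vc).
rewrite (labels_last mb (maximal_chain_ge mc vc) _ uv); last first.
  by rewrite inE uc ltW // covby_lt.
rewrite (labels_head ma (maximal_chain_le mc vc) _ vw); last first.
  by rewrite inE wc ltW // covby_lt.
by rewrite cat_rcons => /cat_sorted2[_] /= /andP[].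
Qed.

Lemma maximal_chain_descent x y z : descent lam x y z ->
  maximal_chain x z [set x; y; z].
Proof.
case/and3P=> xy yz _; have -> : [set x; y; z] = [set x; y] :|: [set y; z].
  by apply/setP=> w; rewrite !inE; case: (w == y); rewrite ?orbT ?orbF.
by apply: (maximal_chain_glue (ltW (covby_lt xy)) (ltW (covby_lt yz)));
  apply: maximal_chain_covby.
Qed.

(** The ascending chain comes first lexicographically, and already at its first
    label: if the first labels were equal, its second label, which is at least
    that common label, would be smaller than the second label of the descent, and
    the descent would ascend. *)
Lemma ascending_precedes_descent x y z c : EL_labeling lam -> descent lam x y z ->
  unique_ascending lam x z c ->
  exists a s, labels lam c = a :: s /\ a < lam x y.
Proof.
move=> EL des /and3P[cmax casc /forallP cuniq].
case/and3P: (des) => xy yz ndes.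
have [ltxy ltyz] := (covby_lt xy, covby_lt yz); have ltxz := lt_trans ltxy ltyz.
have [c0 [/and3P[c0max c0asc _] c0lex]] := EL x z ltxz.
have /eqP c0E : c0 == c by apply: implyP (cuniq c0) _; rewrite c0max.
move: c0E c0lex => -> {c0 c0max c0asc} clex.
have dmax := maximal_chain_descent des.
have dlab : labels lam [set x; y; z] = [:: lam x y; lam y z].
  rewrite (labels_head dmax _ _ xy) ?ltW //; last by rewrite !inE eqxx orbT.
  rewrite (_ : chain_above _ _ = [set y; z]) ?labels_covby //.
  apply/setP=> w; rewrite !inE; have [->|nwx] := eqVneq w x.
    by rewrite (lt_eqF ltxy) (lt_eqF ltxz) lt_geF // andbF.
  have [->|nwy] := eqVneq w y; first by rewrite lexx.
  by have [->|] := eqVneq w z; rewrite //= ltW.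
have [|p [a [b [s [t [cE dE ltab]]]]]] := clex _ dmax.
  by apply: contraNneq ndes => dE; move: casc; rewrite /ascending -dE dlab /= andbT.
move: dE; rewrite dlab; case: p cE => [|p0 [|p1 [|? ?]]] //= cE [].
  by move=> -> _; exists a, s.
move=> p0E bE _; case/negP: ndes; move: casc; rewrite /ascending cE bE p0E.
by case/andP=> le_a _; apply: le_trans (ltW ltab).
Qed.

End Labels.

(** * Polygon moves and their effect on labels *)

Section Moves.
Context {d : Order.disp_t} {P : finTBPOrderType d}.
Context {d' : Order.disp_t} {L : porderType d'}.
Variable lam : P -> P -> L.
Implicit Types (x y z u v w t : P) (c m n : {set P}).

(** A polygon move with its polygon made explicit.  That [m] avoids [y] follows,
    as an ascending chain cannot run through a descent ([move_middle_notin]). *)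
Definition move_at t x y z m m' : Prop :=
  [/\ maximal_chain \bot t m, maximal_chain \bot t m',
      [/\ x \in m, x \in m', z \in m & z \in m'],
      chain_below m x = chain_below m' x /\ chain_above m z = chain_above m' z &
      [/\ descent lam x y z, m' :&: interval x z = [set x; y; z] &
          unique_ascending lam x z (m :&: interval x z)]].

Lemma unique_ascending_notin x y z c :
  descent lam x y z -> unique_ascending lam x z c -> y \notin c.
Proof.
move=> /and3P[xy yz ndes] /and3P[mc asc _]; apply: contraNN ndes => yc.
have xz : x <= z by rewrite ltW // (lt_trans (covby_lt xy)) ?covby_lt.
apply: (ascending_covby mc xz asc) => //.
  exact: maximal_chain_min mc xz.
exact: maximal_chain_max mc xz.
Qed.

Lemma polygon_moveP t m m' :
  polygon_move lam t m m' <-> exists x y z, move_at t x y z m m'.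
Proof.
split.
  case/and3P=> mm mm' /existsP[x /existsP[z /existsP[y]]].
  case/and5P=> _ /setIP[xm xm'] /setIP[zm zm'] /eqP eb /and5P[/eqP ea des /eqP di _ ua].
  by exists x, y, z.
case=> x [y [z [mm mm' [xm xm' zm zm'] [eb ea] [des di ua]]]].
apply/and3P; split=> //; apply/existsP; exists x; apply/existsP; exists z.
apply/existsP; exists y; rewrite !in_setI xm xm' zm zm' eb ea di des ua !eqxx /=.
case/and3P: (des) => /covby_lt xy /covby_lt yz _; rewrite (lt_trans xy yz) andbT /=.
have := unique_ascending_notin des ua; apply: contraNN => ym.
by rewrite !inE ym !ltW.
Qed.

Section OneMove.
Variables (t x y z : P) (m m' : {set P}).
Hypothesis mv : move_at t x y z m m'.

Lemma move_lt_lower : x < y.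
Proof. by case: mv => _ _ _ _ [/and3P[/covby_lt]]. Qed.

Lemma move_lt_upper : y < z.
Proof. by case: mv => _ _ _ _ [/and3P[_ /covby_lt]]. Qed.

Lemma move_lt : x < z.
Proof. exact: lt_trans move_lt_lower move_lt_upper. Qed.

Lemma move_middle : y \in m'.
Proof.
case: mv => _ _ _ _ [_ /setP/(_ y)]; rewrite !inE eqxx orbT.
by case/andP.
Qed.

Lemma move_middle_notin : y \notin m.
Proof.
case: mv => _ _ _ _ [des _ /(unique_ascending_notin des)].
by apply: contraNN => ym; rewrite !inE ym !ltW ?move_lt_lower ?move_lt_upper.
Qed.

Lemma move_neq : m != m'.
Proof. by apply: contraNneq move_middle_notin => ->; apply: move_middle. Qed.

(** Beyond the lexicographic increase itself, this locates it right above the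
    bottom [x] of the polygon, which is what [move_at_top_last] needs. *)
Lemma move_labels : EL_labeling lam -> exists a s s',
  [/\ labels lam m = labels lam (chain_below m x) ++ a :: s,
      labels lam m' = labels lam (chain_below m x) ++ lam x y :: s' &
      a < lam x y].
Proof.
move=> EL; case: (mv) => mm mm' [xm xm' zm zm'] [eb ea] [des di ua].
have [a [s [lE lta]]] := ascending_precedes_descent EL des ua.
have mx := maximal_chain_above mm xm; have mx' := maximal_chain_above mm' xm'.
exists a, (s ++ labels lam (chain_above (chain_above m x) z)).
exists (labels lam (chain_above (chain_above m' x) y)); split=> //.
  rewrite (labels_split _ (maximal_chain_chain mm) xm).
  rewrite (labels_split _ (maximal_chain_chain mx) (_ : z \in _)); last first.
    by rewrite inE zm ltW ?move_lt.
  rewrite (_ : chain_below _ z = m :&: interval x z) ?lE //.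
  by apply/setP=> w; rewrite !inE andbA.
rewrite (labels_split _ (maximal_chain_chain mm') xm') -eb.
rewrite (labels_head _ mx' (maximal_chain_le mm' xm') (_ : y \in _)) //.
  by rewrite inE move_middle ltW ?move_lt_lower.
by case/and3P: des.
Qed.

Lemma move_lex : EL_labeling lam -> lex_precedes (labels lam m) (labels lam m').
Proof.
move=> EL; have [a [s [s' [-> -> lta]]]] := move_labels EL.
by exists (labels lam (chain_below m x)), a, (lam x y), s, s'.
Qed.

End OneMove.

Lemma polygon_move_neq t m m' : polygon_move lam t m m' -> m != m'.
Proof. by case/polygon_moveP=> x [y [z /move_neq]]. Qed.

Lemma polygon_move_max t m m' : polygon_move lam t m m' ->
  maximal_chain \bot t m /\ maximal_chain \bot t m'.
Proof. by case/and3P. Qed.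

Lemma connect_lex t m m' : EL_labeling lam -> connect (polygon_move lam t) m m' ->
  m = m' \/ lex_precedes (labels lam m) (labels lam m').
Proof.
move=> EL /connectP[p]; elim: p m => [|m1 p IHp] m /=; first by left.
case/andP=> /polygon_moveP[x [y [z /move_lex-/(_ EL) lt1]]] pp /(IHp _ pp)[<-|lt2].
  by right.
by right; apply: lex_precedes_trans lt2.
Qed.

(** A sequence of moves which is not empty strictly increases the labels, so it
    cannot be closed. *)
Lemma connect_move_neq t m1 m2 m3 m4 : EL_labeling lam ->
  connect (polygon_move lam t) m1 m2 -> polygon_move lam t m2 m3 ->
  connect (polygon_move lam t) m3 m4 -> m1 != m4.
Proof.
move=> EL /(connect_lex EL) c12 /polygon_moveP[x [y [z /move_lex-/(_ EL) lt23]]].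
move=> /(connect_lex EL) c34; apply/eqP=> e14; rewrite -{}e14 in c34.
have lt21 : lex_precedes (labels lam m2) (labels lam m1).
  by case: c34 => [<-|/(lex_precedes_trans lt23)].
case: c12 => [e12|/(lex_precedes_trans lt21)]; last exact: lex_precedes_irr.
by move: lt21; rewrite e12; apply: lex_precedes_irr.
Qed.

Lemma connect_max t m m' : connect (polygon_move lam t) m m' ->
  maximal_chain \bot t m -> maximal_chain \bot t m'.
Proof.
case/connectP=> p; elim: p m => [|m1 p IHp] m /= => [_ -> //|].
by case/andP=> /polygon_move_max[_ m1m] pp e _; apply: IHp pp e m1m.
Qed.

Lemma mcd_leE t m m' : maximal_chain \bot t m ->
  mcd_le lam t m m' = connect (polygon_move lam t) m m'.
Proof.
move=> mm; rewrite /mcd_le mm /=; apply: andb_idl => c.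
exact: connect_max c mm.
Qed.

(** If the polygon of [n -> m'] had its bottom [a] below [x], then [n] would agree
    with [m] up to [a] and have a smaller label there, since [m] and [m'] agree up
    to [x]; but [m] comes first.  So the descent of [n -> m'] lies in [m'] above
    [x], hence is [x < y < t] itself, and [n] and [m] both consist of the part of
    [m'] below [x] and the ascending chain of [[x, t]]. *)
Lemma move_at_top_last t x y m m' n : EL_labeling lam ->
  move_at t x y t m m' -> connect (polygon_move lam t) m n ->
  polygon_move lam t n m' -> n = m.
Proof.
move=> EL mv cmn /polygon_moveP[a [b [e mv2]]].
have [mm mm' [xm xm' tm tm'] [eb _] [des di ua]] := mv.
have [mn _ [an am' en em'] [eb2 ea2] [des2 di2 ua2]] := mv2.
have [ltab ltbe] := (move_lt_lower mv2, move_lt_upper mv2).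
have bm' := move_middle mv2.
have /orP[xa|] : (x <= a) || (a < x).
- have /orP[ax|->//] := maximal_chain_comparable mm' am' xm'.
  by rewrite le_eqVlt in ax; case/predU1P: ax => [->|->]; rewrite ?lexx ?orbT.
- have inI w : w \in m' -> x <= w -> w \in [set x; y; t].
    by move=> wm' xw; rewrite -di !inE wm' xw (maximal_chain_le mm').
  have xy := move_lt_lower mv; have yt := move_lt_upper mv; have xt := move_lt mv.
  have eI := inI e em' (le_trans xa (ltW (lt_trans ltab ltbe))).
  have bI := inI b bm' (le_trans xa (ltW ltab)).
  have [bE eE] : b = y /\ e = t.
    have xb := le_lt_trans xa ltab.
    move: bI; rewrite !inE (gt_eqF xb) /= => /orP[/eqP bE|/eqP bE]; last first.
      by have := maximal_chain_le mm' em'; rewrite -bE (lt_geF ltbe).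
    move: eI; rewrite !inE (gt_eqF (lt_trans xb ltbe)) -bE (gt_eqF ltbe) /=.
    by move/eqP.
  have aE : a = x.
    have := inI a am' xa; rewrite !inE => /orP[/orP[]|] /eqP // aE.
      by move: ltab; rewrite bE aE ltxx.
    by move: ltab; rewrite bE aE (lt_gtF yt).
  rewrite {}aE {}eE {a e b mv2 an am' en em' ltab ltbe eI bI inI bE xa di2 des2 bm'}
    in eb2 ea2 ua2 *.
  have eI : n :&: interval x t = m :&: interval x t.
    case/and3P: ua => _ _ /forallP/(_ (n :&: interval x t)).
    by case/and3P: ua2 => -> -> _ /= /eqP.
  have xn : x \in n by move/setP/(_ x): eb2; rewrite !inE xm' lexx !andbT.
  by apply: (maximal_chain_eq mn mm xn xm); rewrite // eb2.
move=> ax; exfalso.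
have des2cov : covby a b by case/and3P: des2.
have bx : b <= x.
  have /orP[xa|//] := maximal_chain_covby_cases mm' am' bm' xm' des2cov.
  by move: xa; rewrite (lt_geF ax).
have below w : w <= x -> (w \in m) = (w \in m').
  by move=> wx; move/setP/(_ w): eb; rewrite !inE wx !andbT.
have am : a \in m by rewrite below // ltW.
have bm : b \in m by rewrite below.
have lnm : lex_precedes (labels lam n) (labels lam m).
  have [l [s [s' [-> _ ltl]]]] := move_labels mv2 EL.
  have ma := maximal_chain_above mm am.
  exists (labels lam (chain_below n a)), l, (lam a b), s.
  exists (labels lam (chain_above (chain_above m a) b)); split=> //.
  rewrite (labels_split _ (maximal_chain_chain mm) am).
  rewrite (labels_head _ ma (maximal_chain_le mm am) _ des2cov); last first.
    by rewrite inE bm ltW.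
  rewrite eb2; congr (labels _ _ ++ _); apply/setP=> w; rewrite !inE.
  by have [wa|] := boolP (w <= a); rewrite ?andbF // !andbT below // (le_trans wa) ?ltW.
case: (connect_lex EL cmn) => [mE|/(lex_precedes_trans lnm)].
  by move: lnm; rewrite mE; apply: lex_precedes_irr.
exact: lex_precedes_irr.
Qed.

End Moves.

(** * Restricting and extending moves *)

Section Transport.
Context {d : Order.disp_t} {P : finTBPOrderType d}.
Context {d' : Order.disp_t} {L : porderType d'}.
Variable lam : P -> P -> L.
Implicit Types (x y z u v w t : P) (c m n : {set P}).

Lemma move_at_below t x y z m m' u : move_at lam t x y z m m' ->
  u \in m -> z <= u ->
  u \in m' /\ move_at lam u x y z (chain_below m u) (chain_below m' u).
Proof.
move=> mv um zu; have xz := move_lt mv.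
case: mv => mm mm' [xm xm' zm zm'] [/setP eb /setP ea] [des di ua].
have um' : u \in m' by have := ea u; rewrite !inE um zu !andbT => <-.
have xu : x <= u := le_trans (ltW xz) zu.
split=> //; split.
- exact: (maximal_chain_below mm um).
- exact: (maximal_chain_below mm' um').
- by split; rewrite inE ?xm ?xm' ?zm ?zm'.
- split; apply/setP=> w; last first.
    by have := ea w; rewrite !inE; case: (w <= u); rewrite ?andbF ?andbT.
  by have := eb w; rewrite !inE; case: (w <= u); rewrite ?andbF ?andbT.
have low n : chain_below n u :&: interval x z = n :&: interval x z.
  apply/setP=> w; rewrite !inE -andbA; case: (w \in n) => //=.
  by rewrite andb_idl // => /andP[_ wz]; apply: le_trans zu.
by rewrite !low.
Qed.

Lemma polygon_move_append u t m m' n : u <= t -> maximal_chain u t n ->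
  polygon_move lam u m m' -> polygon_move lam t (m :|: n) (m' :|: n).
Proof.
move=> ut mn /polygon_moveP[x [y [z mv]]]; apply/polygon_moveP.
have xz := move_lt mv.
case: mv => mm mm' [xm xm' zm zm'] [/setP eb /setP ea] [des di ua].
have zu := maximal_chain_le mm zm.
have low n' : maximal_chain \bot u n' -> z \in n' ->
    (n' :|: n) :&: interval x z = n' :&: interval x z.
  move=> mn' zn'; apply/setP=> w; rewrite !inE andb_orl.
  apply: orb_idr => /and3P[wn -> wz]; rewrite wz !andbT.
  have uw := maximal_chain_ge mn wn.
  suff -> : w = z by [].
  by apply: le_anti; rewrite wz (le_trans zu).
exists x, y, z; split; last by rewrite !low.
- exact: maximal_chain_glue (le0x u) ut mm mn.
- exact: maximal_chain_glue (le0x u) ut mm' mn.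
- by split; rewrite inE ?xm ?xm' ?zm ?zm'.
split; apply/setP=> w; first by have := eb w; rewrite !inE !andb_orl => ->.
by have := ea w; rewrite !inE !andb_orl => ->.
Qed.

Lemma connect_append u t m m' n : u <= t -> maximal_chain u t n ->
  connect (polygon_move lam u) m m' ->
  connect (polygon_move lam t) (m :|: n) (m' :|: n).
Proof.
move=> ut mn /connectP[p]; elim: p m => [|m1 p IHp] m /=; first by move=> _ ->.
case/andP=> mv pp /(IHp _ pp); apply: connect_trans.
exact/connect1/(polygon_move_append ut mn).
Qed.

Lemma unique_ascending_move m0 c x y z : maximal_chain \bot x m0 ->
  descent lam x y z -> unique_ascending lam x z c ->
  polygon_move lam z (m0 :|: c) (m0 :|: [set x; y; z]).
Proof.
move=> mm0 des ua; apply/polygon_moveP; exists x, y, z.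
have mdes := maximal_chain_descent des.
case/and3P: (ua) => mc _ _; case/and3P: (des) => /covby_lt xy /covby_lt yz _.
have xz := ltW (lt_trans xy yz).
have xm0 := maximal_chain_max mm0 (le0x x).
have zc := maximal_chain_max mc xz.
have high n : maximal_chain x z n -> (m0 :|: n) :&: interval x z = n.
  move=> mn; apply/setP=> w; rewrite !inE andb_orl.
  have -> : (w \in n) && (x <= w <= z) = (w \in n).
    by apply: andb_idr => wn; rewrite (maximal_chain_ge mn) ?(maximal_chain_le mn).
  apply: orb_idl => /and3P[wm0 xw _].
  suff -> : w = x by apply: maximal_chain_min mn xz.
  by apply: le_anti; rewrite xw (maximal_chain_le mm0).
have low n : maximal_chain x z n -> chain_below (m0 :|: n) x = m0.
  move=> mn; apply/setP=> w; rewrite !inE andb_orl.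
  have -> : (w \in m0) && (w <= x) = (w \in m0).
    by apply: andb_idr => /(maximal_chain_le mm0).
  apply: orb_idr => /andP[wn wx].
  suff -> : w = x by [].
  by apply: le_anti; rewrite wx (maximal_chain_ge mn).
have top n : maximal_chain x z n -> chain_above (m0 :|: n) z = [set z].
  move=> mn; have zn := maximal_chain_max mn xz.
  apply/setP=> w; rewrite !inE; apply/andP/eqP => [[/orP[wm0|wn] zw]|->].
  - have := le_trans zw (maximal_chain_le mm0 wm0).
    by rewrite (lt_geF (lt_trans xy yz)).
  - by apply: le_anti; rewrite zw (maximal_chain_le mn).
  by rewrite zn orbT lexx.
split; first exact: maximal_chain_glue (le0x x) xz mm0 mc.
- exact: maximal_chain_glue (le0x x) xz mm0 mdes.
- by split; rewrite !inE ?xm0 ?zc ?eqxx ?orbT.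
- by rewrite !low ?top.
by rewrite !high.
Qed.

Lemma move_at_top_below t x y m m' u : move_at lam t x y t m m' ->
  u \in m -> covby u t -> let c := m :&: interval x t in
  [/\ u \in c, t \in c,
      chain_below m u = chain_below m x :|: chain_below c u &
      chain_below m' y = chain_below m x :|: [set x] :|: [set y]].
Proof.
move=> mv um ut c; have xt := move_lt mv; have ltxy := move_lt_lower mv.
have ym' := move_middle mv.
case: mv => mm mm' [xm xm' tm tm'] [eb ea] [/and3P[xy yt _] di ua].
have xu : x <= u.
  have /orP[//|tx] := maximal_chain_covby_cases mm um tm xm ut.
  by move: tx; rewrite lt_geF.
split.
- by rewrite !inE um xu ltW ?covby_lt.
- by rewrite !inE tm (ltW xt) lexx.
- apply/setP=> w; rewrite !inE; case wm: (w \in m) => //=.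
  apply/idP/orP => [wu|[wx|/andP[_ ->] //]]; last exact: le_trans xu.
  have /orP[->|xw] := maximal_chain_comparable mm wm xm; first by left.
  by right; rewrite xw (maximal_chain_le mm wm) wu.
rewrite eb; apply/setP=> w; rewrite !inE.
apply/andP/orP => [[wm' wy]|].
  have /orP[->|xw] := maximal_chain_comparable mm' wm' xm'; first by rewrite wm'; left.
  have : w \in [set x; y; t] by rewrite -di !inE wm' xw (maximal_chain_le mm').
  rewrite !inE -orbA => /or3P[->|->|/eqP wt]; [by left; rewrite orbT|by right|].
  by move: wy; rewrite wt (lt_geF (covby_lt yt)).
case=> [/orP[/andP[-> wx]|/eqP->]|/eqP->].
- by rewrite (le_trans wx) // ltW.
- by rewrite xm' ltW.
by rewrite ym' lexx.
Qed.

End Transport.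

(** * Paths of moves cut at their coatom changes *)

Section Crossings.
Context {d : Order.disp_t} {P : finTBPOrderType d}.
Context {d' : Order.disp_t} {L : porderType d'}.
Variable lam : P -> P -> L.
Implicit Types (t y u v w : P) (c m n : {set P}).

(** A move of [[0, y]] from [m :|: c] to [m :|: [set z; x'; y]], which replaces the
    coatom [x] of the chain by [x']. *)
Definition crossing y x z x' c m : Prop :=
  [/\ descent lam z x' y, unique_ascending lam z y c, covby x y,
      (x \in c) && (y \in c) & maximal_chain \bot z m].

(** The two ends are kept free, so that such a path can be built by prepending
    crossings; the theorem concerns the closed case [x = x']. *)
Definition crossing_path y x n x' n' : Prop :=
  exists k (xs zs : nat -> P) (cs ms : nat -> {set P}),
    [/\ (1 <= k)%N, xs 1%N = x, xs k.+1 = x',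
        forall i, (1 <= i <= k)%N ->
          crossing y (xs i) (zs i) (xs i.+1) (cs i) (ms i) &
        [/\ mcd_le lam x n (ms 1%N :|: chain_below (cs 1%N) x),
            forall i, (1 <= i <= k.-1)%N ->
              mcd_lt lam (xs i.+1) (ms i :|: [set zs i] :|: [set xs i.+1])
                (ms i.+1 :|: chain_below (cs i.+1) (xs i.+1)) &
            mcd_le lam x' (ms k :|: [set x']) n']].

Lemma mcd_le_trans t m n p :
  mcd_le lam t m n -> mcd_le lam t n p -> mcd_le lam t m p.
Proof.
by case/and3P=> mm _ mn /and3P[_ mp np]; rewrite mcd_leE // (connect_trans mn).
Qed.

Lemma crossing_lt y x z x' c m : crossing y x z x' c m -> z < x.
Proof.
case=> /and3P[zx' x'y _] /and3P[mc _ _] xy /andP[xc _] _.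
rewrite lt_neqAle (maximal_chain_ge mc xc) andbT; apply/eqP=> zx.
case/andP: xy => _ /forallP/(_ x').
by rewrite -zx (covby_lt zx') (covby_lt x'y).
Qed.

(** This rules out a closed crossing path with a single crossing. *)
Lemma crossing_neq_coatom y x z x' c m : crossing y x z x' c m -> x != x'.
Proof.
case=> des ua _ /andP[xc _] _; apply: contraTneq xc => ->.
exact: unique_ascending_notin des ua.
Qed.

(** The chain left behind by a crossing ends with a descent into [y], while the
    chain entering the next crossing ends with an ascending chain of length at
    least two into [y]. *)
Lemma crossing_crossing_neq y x z x1 c m z' x2 c' m' :
  crossing y x z x1 c m -> crossing y x1 z' x2 c' m' ->
  m :|: [set z] :|: [set x1] != m' :|: chain_below c' x1.
Proof.
move=> [des _ _ _ mm] cr'; have z'x1 := crossing_lt cr'.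
case: cr' => _ /and3P[mc' asc' _] x1y /andP[x1c' yc'] mm'.
case/and3P: (des) => zx1 _ /negP ndes; apply/eqP=> /setP E; apply: ndes.
have ltz'y := lt_trans z'x1 (covby_lt x1y).
have z'c' := maximal_chain_min mc' (ltW ltz'y).
have z'z : z' <= z.
  have := E z'; rewrite !inE z'c' (ltW z'x1) orbT (lt_eqF z'x1) orbF.
  by case/orP=> [/(maximal_chain_le mm)|/eqP->].
have zc' : z \in c'.
  have := E z; rewrite !inE eqxx orbT => /esym/orP[zm'|/andP[//]].
  suff <- : z' = z by [].
  by apply: le_anti; rewrite z'z (maximal_chain_le mm').
exact: (ascending_covby mc' (ltW ltz'y) asc').
Qed.

Lemma crossing_path_le y x n0 n x' n' :
  mcd_le lam x n0 n -> crossing_path y x n x' n' -> crossing_path y x n0 x' n'.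
Proof.
move=> le0 [k [xs [zs [cs [ms [k1 x1 xk cr [le1 lt2 le3]]]]]]].
exists k, xs, zs, cs, ms; split=> //; split=> //.
exact: mcd_le_trans le1.
Qed.

Lemma crossing_maximal y x z x' c m : crossing y x z x' c m ->
  maximal_chain \bot x (m :|: chain_below c x) /\
  maximal_chain \bot x' (m :|: [set x']).
Proof.
move=> cr; have /ltW zx := crossing_lt cr.
case: cr => /and3P[zx' _ _] /and3P[mc _ _] _ /andP[xc _] mm; split.
  exact: maximal_chain_glue (le0x z) zx mm (maximal_chain_below mc xc).
have -> : m :|: [set x'] = m :|: [set z; x'].
  rewrite setUA; congr (_ :|: _); apply/esym/setUidPl.
  by rewrite sub1set (maximal_chain_max mm (le0x z)).
apply: (maximal_chain_glue (le0x z) (ltW (covby_lt zx')) mm).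
exact: maximal_chain_covby.
Qed.

Lemma crossing_path_one y x z x' c m n' : crossing y x z x' c m ->
  mcd_le lam x' (m :|: [set x']) n' ->
  crossing_path y x (m :|: chain_below c x) x' n'.
Proof.
move=> cr le3; have [mx _] := crossing_maximal cr.
exists 1%N, (fun i => if i is j.+2 then x' else x), (fun=> z), (fun=> c), (fun=> m).
split=> //; first by case=> [|[|i]].
split=> //; last by case=> [|i] //=; rewrite andbF.
by rewrite mcd_leE.
Qed.

Lemma crossing_path_cons y x z x1 c m x' n' : crossing y x z x1 c m ->
  crossing_path y x1 (m :|: [set x1]) x' n' ->
  crossing_path y x (m :|: chain_below c x) x' n'.
Proof.
move=> cr [k [xs [zs [cs [ms [k1 xs1 xsk crs [le1 lt2 le3]]]]]]].
have [mx mx1] := crossing_maximal cr.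
(* Families are indexed from 1, so [a] has to be placed at index 1. *)
pose cons_fun T (a : T) f i : T := if i is j.+2 then f j.+1 else a.
exists k.+1, (cons_fun _ x xs), (cons_fun _ z zs), (cons_fun _ c cs), (cons_fun _ m ms).
split=> //; first by case=> [|[|i]] //= ik; rewrite ?xs1 //; apply: crs.
split; first by rewrite mcd_leE.
- case=> [|[|i]] //= ik; last by apply: lt2; case: (k) ik.
  have cr1 : crossing y x1 (zs 1%N) (xs 2%N) (cs 1%N) (ms 1%N).
    by have := crs 1%N; rewrite xs1; apply.
  rewrite xs1 /mcd_lt (crossing_crossing_neq cr cr1) andbT.
  suff -> : m :|: [set z] = m by [].
  apply/setUidPl; rewrite sub1set.
  by case: cr => _ _ _ _ mm; apply: maximal_chain_max mm (le0x z).
by case: k k1 le3 {xsk crs lt2}.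
Qed.

Lemma coatom_unique t m u v : maximal_chain \bot t m -> u \in m -> v \in m ->
  covby u t -> covby v t -> u = v.
Proof.
move=> mm um vm ut vt; have tm := maximal_chain_max mm (le0x t).
have le a b : a \in m -> b \in m -> covby a t -> covby b t -> a <= b.
  move=> am bm a_t b_t.
  have /orP[//|ta] := maximal_chain_covby_cases mm bm tm am b_t.
  by move: ta; rewrite (lt_geF (covby_lt a_t)).
by apply: le_anti; rewrite !le.
Qed.

(** A move whose polygon stays below the coatom of the chain is a move of the
    shorter chain; a move whose polygon reaches [t] is a crossing to a new
    coatom. *)
Lemma path_crossings t x x' n p : maximal_chain \bot t n ->
  x \in n -> covby x t -> path (polygon_move lam t) n p ->
  x' \in last n p -> covby x' t ->
  (x = x' /\ path (polygon_move lam x) (chain_below n x)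
                  [seq chain_below m x | m <- p]) \/
  crossing_path t x (chain_below n x) x' (chain_below (last n p) x').
Proof.
elim: p n x => [|n1 p IHp] n x mn xn xt /=.
  by move=> _ x'n x't; left; split=> //; apply: coatom_unique x'n xt x't.
case/andP=> mv pp x'p x't; have [_ mn1] := polygon_move_max mv.
have tn := maximal_chain_max mn (le0x t).
case/polygon_moveP: mv => a [b [e mv]].
have [_ _ [an _ en en1] _ [des _ ua]] := mv.
have := maximal_chain_le mn en; rewrite le_eqVlt => /orP[/eqP et|et].
  rewrite {e}et in mv des ua en en1.
  have [xc tc -> n1b] := move_at_top_below mv xn xt.
  have bt : covby b t by case/and3P: des.
  have cr : crossing t x a b (n :&: interval a t) (chain_below n a).
    by split; rewrite ?xc //; apply: (maximal_chain_below mn an).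
  have n1bE : chain_below n1 b = chain_below n a :|: [set b].
    rewrite n1b; congr (_ :|: _); apply/setUidPl.
    by rewrite sub1set inE an lexx.
  have bn1 := move_middle mv; right.
  case: (IHp n1 b mn1 bn1 bt pp x'p x't) => [[bx' pb]|cp].
    rewrite -bx'; apply: (crossing_path_one cr).
    rewrite -n1bE mcd_leE; last exact: (maximal_chain_below mn1 bn1).
    apply/connectP; exists [seq chain_below m b | m <- p] => //.
    by rewrite (last_map (fun m => chain_below m b)).
  by apply: (crossing_path_cons cr); rewrite -n1bE.
have ex : e <= x.
  have /orP[//|te] := maximal_chain_covby_cases mn xn tn en xt.
  by move: te; rewrite (lt_geF et).
have [xn1 mvx] := move_at_below mv xn ex.
have pmx : polygon_move lam x (chain_below n x) (chain_below n1 x).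
  by apply/polygon_moveP; exists a, b, e.
case: (IHp n1 x mn1 xn1 xt pp x'p x't) => [[xx' px]|cp].
  by left; rewrite pmx.
right; apply: crossing_path_le cp; have [mx _] := polygon_move_max pmx.
by rewrite mcd_leE // connect1.
Qed.

(** Refinements are recorded as paths of moves rather than by an intermediate
    chain, so that they can be restricted step by step to a smaller interval. *)
Definition refined_move t : Prop := exists m m' p,
  [/\ polygon_move lam t m m', path (polygon_move lam t) m p, last m p = m' &
      (2 <= size p)%N].

(** A move whose polygon reaches [t] has no refinement, so the chains
    [m] and [m'] of a refined move share their coatom; if the refining path keeps
    that coatom throughout, it refines a move in a smaller interval. *)
Lemma refined_move_crossing_path t : EL_labeling lam -> refined_move t ->
  exists y x m m', polygon_move lam x m m' /\ crossing_path y x m x m'.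
Proof.
move=> EL; have [k] := ubnP #|interval \bot t|.
elim: k t => // k IHk t tk [m [m' [p [mv pp pE p2]]]].
have [mm mm'] := polygon_move_max mv.
case/polygon_moveP: (mv) => a [b [e mva]].
have [_ _ [am _ em em'] _ _] := mva.
have := maximal_chain_le mm em; rewrite le_eqVlt => /orP[/eqP et|et].
  exfalso; rewrite {e}et in mva em em'.
  case/lastP: p pp pE p2 => [//|p n]; rewrite last_rcons rcons_path => /andP[pp mvn].
  move=> nE; rewrite {n}nE in mvn *; rewrite size_rcons ltnS => p1.
  have cmn : connect (polygon_move lam t) m (last m p).
    by apply/connectP; exists p.
  have nE := move_at_top_last EL mva cmn mvn.
  case: p pp p1 nE {cmn mvn} => [//|n p] /= /andP[mv1 pp] _ nE.
  have : m != m.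
    rewrite -{2}nE; apply: connect_move_neq (connect0 _ _) mv1 _ => //.
    by apply/connectP; exists p.
  by rewrite eqxx.
have [x xm xt] := maximal_chain_coatom mm (le_lt_trans (le0x e) et).
have tm := maximal_chain_max mm (le0x t).
have ex : e <= x.
  have /orP[//|te] := maximal_chain_covby_cases mm xm tm em xt.
  by move: te; rewrite (lt_geF et).
have [xm' mvx] := move_at_below mva xm ex.
have pmx : polygon_move lam x (chain_below m x) (chain_below m' x).
  by apply/polygon_moveP; exists a, b, e.
rewrite -pE in xm'.
case: (path_crossings mm xm xt pp xm' xt) => [[_ px]|cp].
  apply: (IHk x).
    rewrite -ltnS; apply: leq_trans tk; rewrite ltnS.
    apply: proper_card; apply/properP; split.
      apply/subsetP=> w; rewrite !inE !le0x /= => wx.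
      by rewrite (le_trans wx) // ltW // covby_lt.
    by exists t; rewrite !inE !le0x ?lexx //= (lt_geF (covby_lt xt)).
  exists (chain_below m x), (chain_below m' x), [seq chain_below n x | n <- p].
  by rewrite (last_map (fun n => chain_below n x)) pE size_map.
by exists t, x, (chain_below m x), (chain_below m' x); split; rewrite // -pE.
Qed.

Lemma not_polygon_complete_refined :
  ~ polygon_complete lam -> refined_move \top.
Proof.
move=> npc.
have [/existsP[m /existsP[m' /andP[mv ncov]]]|none] := boolP [exists m, exists m',
    polygon_move lam \top m m' && ~~ mcd_cover lam \top m m']; last first.
  case: npc => m m' mv; apply: contraNT none => ncov.
  by apply/existsP; exists m; apply/existsP; exists m'; rewrite mv.
have [mm mm'] := polygon_move_max mv.
move: ncov; rewrite /mcd_cover {1}/mcd_lt mcd_leE // connect1 //.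
rewrite (polygon_move_neq mv) /= negb_forall => /existsP[n]; rewrite negbK.
case/andP=> /andP[/and3P[_ mn /connectP[p1 pp1 p1E]] mneq].
case/andP=> /and3P[_ _ /connectP[p2 pp2 p2E]] nneq.
exists m, m', (p1 ++ p2); split=> //.
- by rewrite cat_path pp1 -p1E.
- by rewrite last_cat -p1E -p2E.
have p1_gt0 : (0 < size p1)%N.
  by case: p1 p1E {pp1} mneq => //= <-; rewrite eqxx.
have p2_gt0 : (0 < size p2)%N.
  by case: p2 p2E {pp2} nneq => //= <-; rewrite eqxx.
by rewrite size_cat (leq_add p1_gt0 p2_gt0).
Qed.

End Crossings.

(** * Crossing data refine a move *)

Section Converse.
Context {d : Order.disp_t} {P : finTBPOrderType d}.
Context {d' : Order.disp_t} {L : porderType d'}.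
Variable lam : P -> P -> L.
Implicit Types (t y u v w x z : P) (c m n : {set P}).

Lemma crossing_move y x z x' c m tl : crossing lam y x z x' c m ->
  maximal_chain y \top tl ->
  polygon_move lam \top (m :|: chain_below c x :|: ([set x; y] :|: tl))
    (m :|: [set z] :|: [set x'] :|: ([set x'; y] :|: tl)).
Proof.
move=> [des ua xy /andP[xc yc] mm] mtl.
have := polygon_move_append (lex1 y) mtl (unique_ascending_move mm des ua).
congr (polygon_move _ _ _ _); last first.
  by apply/setP=> w; rewrite !inE; case: (w == x'); rewrite ?orbT ?orbF // !orbA.
case/and3P: ua => mc _ _; apply/setP=> w; rewrite !inE !orbA.
congr (_ || _); rewrite -!orbA; congr (_ || _).
apply/idP/or3P => [wc|[/andP[]|/eqP->|/eqP->] //].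
have /orP[wx|yw] := maximal_chain_covby_cases mc xc yc wc xy.
  by constructor 1; rewrite wc.
by constructor 3; apply/eqP/le_anti; rewrite yw (maximal_chain_le mc wc).
Qed.

(** Appending [x < y] and a fixed chain above [y] embeds each order on the
    maximal chains below a coatom [x] of [y] into the order on the maximal chains
    of the whole poset; the crossings become moves there, which link the pieces
    of the crossing path together. *)
Lemma crossing_path_refines y x m m' :
  EL_labeling lam -> covby x y -> polygon_move lam x m m' ->
  crossing_path lam y x m x m' -> ~ polygon_complete lam.
Proof.
move=> EL xy mv [k [xs [zs [cs [ms [k1 xs1 xsk cr [le1 lt2 le3]]]]]]] pc.
have [tl mtl _] : exists2 tl, maximal_chain y \top tl & set0 \subset tl.
  apply: maximal_chain_extend => [|w]; rewrite ?inE //.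
  by apply/is_chainP=> u v; rewrite inE.
pose above u := [set u; y] :|: tl.
have mabove u : covby u y -> maximal_chain u \top (above u).
  move=> uy; apply: maximal_chain_glue (ltW (covby_lt uy)) (lex1 y) _ mtl.
  exact: maximal_chain_covby.
have lift u n n' : covby u y -> mcd_le lam u n n' ->
    connect (polygon_move lam \top) (n :|: above u) (n' :|: above u).
  move=> uy /and3P[_ _]; apply: connect_append (lex1 u) (mabove u uy).
(* The extended chains before and after the [i]-th crossing. *)
pose U i := ms i :|: chain_below (cs i) (xs i) :|: above (xs i).
pose V i := ms i :|: [set zs i] :|: [set xs i.+1] :|: above (xs i.+1).
have UV i : (1 <= i <= k)%N -> polygon_move lam \top (U i) (V i).
  by move=> /cr/crossing_move; apply.
have VU i : (1 <= i <= k.-1)%N -> connect (polygon_move lam \top) (V i) (U i.+1).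
  move=> ik; apply: lift; last by case/andP: (lt2 i ik).
  have /cr[] // : (1 <= i.+1 <= k)%N.
  by case/andP: ik => _; case: (k) k1 => [//|k'] _ /=; rewrite ltnS.
have VV i : (1 <= i <= k)%N -> connect (polygon_move lam \top) (V i) (V k).
  case/andP=> i1 ik; have := leqnn k; rewrite -{1 3}(subnKC ik).
  elim: (k - i)%N => [|l IHl]; first by rewrite addn0.
  rewrite addnS => lk; apply: connect_trans (IHl (ltnW lk)) _.
  apply: connect_trans (VU (i + l)%N _) (connect1 (UV (i + l).+1 lk)).
  by rewrite (leq_trans i1 (leq_addr _ _)) /= -ltnS (ltn_predK lk).
have k_gt1 : (2 <= k)%N.
  case: (k) k1 xsk cr => [|[|//]] // _ xs2 /(_ 1%N isT).
  by move/crossing_neq_coatom; rewrite xs1 xs2 eqxx.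
have mU1 : connect (polygon_move lam \top) (m :|: above x) (U 1%N).
  by rewrite /U xs1; apply: lift.
have Vkm' : connect (polygon_move lam \top) (V k) (m' :|: above x).
  have := lift x _ _ xy le3; congr connect; rewrite /V xsk; congr (_ :|: _ :|: _).
  have [_ _ _ _ mk] : crossing lam y (xs k) (zs k) (xs k.+1) (cs k) (ms k).
    by apply: cr; rewrite k1 leqnn.
  by apply/esym/setUidPl; rewrite sub1set (maximal_chain_max mk) ?le0x.
have UV1 : polygon_move lam \top (U 1%N) (V 1%N) by apply: UV; rewrite k1.
have mvM := polygon_move_append (lex1 x) (mabove x xy) mv.
have [mM mM'] := polygon_move_max mvM.
have mV1 : connect (polygon_move lam \top) (m :|: above x) (V 1%N).
  exact: connect_trans mU1 (connect1 UV1).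
have V1m' : connect (polygon_move lam \top) (V 1%N) (m' :|: above x).
  by apply: connect_trans (VV 1%N _) Vkm'; rewrite k1.
have [_ mV] := polygon_move_max UV1.
have /andP[_ /forallP/(_ (V 1%N))/negP] := pc _ _ mvM; apply.
rewrite /mcd_lt !mcd_leE // mV1 V1m' /=; apply/andP; split.
  exact: connect_move_neq EL mU1 UV1 (connect0 _ _).
have k1k : (1 <= 1 <= k.-1)%N by case: (k) k_gt1.
apply: connect_move_neq EL (VU 1%N k1k) (UV 2%N k_gt1) _.
exact: connect_trans (VV 2%N k_gt1) Vkm'.
Qed.

End Converse.

(** * Characterization of polygon completeness *)

Theorem theorem4p20 (d : Order.disp_t) (P : finTBPOrderType d)
    (d' : Order.disp_t) (L : porderType d') (lam : P -> P -> L)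
    (EL : EL_labeling lam) :
  ~ polygon_complete lam <->
  (exists c : {set P}, maximal_chain \bot \top c /\ (3 <= chain_length c)%N) /\
  (exists (n : nat) (y : P) (x z : nat -> P) (c : nat -> {set P}),
    [/\ (2 <= n)%N, x n.+1 = x 1%N,
      (forall i : nat, (1 <= i <= n)%N ->
         [/\ descent lam (z i) (x i.+1) y,
             unique_ascending lam (z i) y (c i),
             covby (x i) y & (x i \in c i) && (y \in c i)]) &
      exists (m m' : {set P}) (m_ : nat -> {set P}),
        [/\ [/\ maximal_chain \bot (x 1%N) m, (1 <= chain_length m)%N,
                maximal_chain \bot (x 1%N) m', (1 <= chain_length m')%N &
                polygon_move lam (x 1%N) m m'],
            (forall i : nat, (1 <= i <= n)%N ->
               maximal_chain \bot (z i) (m_ i) /\ (1 <= chain_length (m_ i))%N),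
            mcd_le lam (x 1%N) m (m_ 1%N :|: chain_below (c 1%N) (x 1%N)),
            (forall i : nat, (1 <= i <= n.-1)%N ->
               mcd_lt lam (x i.+1) (m_ i :|: [set z i] :|: [set x i.+1])
                 (m_ i.+1 :|: chain_below (c i.+1) (x i.+1))) &
            mcd_le lam (x 1%N) (m_ n :|: [set x 1%N]) m']]).
Proof.
split; last first.
  case=> _ [n [y [x [z [c [n2 xn xzc [m [m' [m_ [[_ _ _ _ mv] mm le1 lt2 le3]]]]]]]]]].
  have n1 := ltnW n2.
  apply: (crossing_path_refines (y := y) EL _ mv).
    by case: (xzc 1%N) => //; rewrite n1.
  exists n, x, z, c, m_; split=> // i i_n.
  by case: (xzc i i_n) => *; split=> //; case: (mm i i_n).
move=> /not_polygon_complete_refined/(refined_move_crossing_path EL).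
case=> y [x [m [m' [mv [n [xs [zs [cs [ms [n1 xs1 xsn cr [le1 lt2 le3]]]]]]]]]]].
have [mm mm'] := polygon_move_max mv; have neq_mm' := polygon_move_neq mv.
have n2 : (2 <= n)%N.
  case: (n) n1 xsn cr => [|[|//]] // _ xs2 /(_ 1%N isT).
  by move/crossing_neq_coatom; rewrite xs1 xs2 eqxx.
(* If [zs i] were the bottom element, [xs i.+1] would cover it, and the interval
   below [xs i.+1] would have a single maximal chain.  But two distinct ones are
   compared there: after an inner crossing by the strict comparison, after the
   last one by [m] and [m']. *)
have zpos i : (1 <= i <= n)%N -> \bot < zs i.
  move=> i_n; rewrite lt0x; apply/eqP=> zi0.
  have [/and3P[cov _ _] _ _ _ _] := cr i i_n; rewrite zi0 in cov.
  have single := maximal_chain_covby_eq cov.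
  have [i_lt|i_ge] := ltnP i n.
    have /lt2/andP[/and3P[/single-> /single-> _]] : (1 <= i <= n.-1)%N.
      by case/andP: i_n => -> _; case: (n) i_lt.
    by rewrite eqxx.
  have iE : i = n by apply/eqP; rewrite eqn_leq i_ge; case/andP: i_n => _ ->.
  rewrite iE xsn in single.
  by move: neq_mm'; rewrite (single _ mm) (single _ mm') eqxx.
have length_gt0 u n' : \bot < u -> maximal_chain \bot u n' -> (1 <= chain_length n')%N.
  move=> u0 mn; rewrite /chain_length -ltnS.
  have sub : [set \bot; u] \subset n'.
    apply/subsetP=> w /set2P[]->; first exact: maximal_chain_min mn (le0x u).
    exact: maximal_chain_max mn (le0x u).
  have := subset_leq_card sub; rewrite cards2 (lt_eqF u0) /=.
  by case: #|n'| => [|[]].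
have n_1 : (1 <= 1 <= n)%N by rewrite n1.
have [/and3P[/covby_lt zx /covby_lt xy _] _ _ _ _] := cr 1%N n_1.
have z0 := zpos 1%N n_1.
have x0 : \bot < x by rewrite -xs1; apply: lt_trans z0 (crossing_lt (cr 1%N n_1)).
split.
  pose c0 := [set \bot; zs 1%N; xs 2%N; y].
  have [|w _|c mc sub] := @maximal_chain_extend _ P \bot \top c0.
  - apply/is_chainP=> u v; rewrite !inE -!orbA.
    have zy := lt_trans zx xy; have bx := lt_trans z0 zx; have by0 := lt_trans z0 zy.
    by case/or4P=> /eqP-> /or4P[]/eqP->; first
      [exact: comparablexx | by apply/le_comparable/ltW | by apply/ge_comparable/ltW].
  - by rewrite le0x lex1.
  have c4 : (4 <= #|c|)%N.
    apply/card_geqP; exists [:: \bot; zs 1%N; xs 2%N; y]; split=> //.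
      by apply: (sorted_uniq lt_trans ltxx); rewrite /= z0 zx xy.
    by move=> w ws; apply: (subsetP sub); rewrite !inE -!orbA in ws *.
  by exists c; rewrite /chain_length -ltnS prednK // (ltn_trans _ c4).
exists n, y, xs, zs, cs; split=> //; first by rewrite xs1.
  by move=> i /cr[].
exists m, m', ms; rewrite xs1; split=> //.
  by split=> //; apply: length_gt0 x0 _.
move=> i i_n; have [_ _ _ _ mi] := cr i i_n; split=> //.
exact: length_gt0 (zpos i i_n) mi.
Qed.
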